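(* Let $d\ge 2$, $n\ge 1$, $k\ge 1$ be integers, and let $T_d(n)$ be the complete $d$-ary tree on $n+1$ levels, with edges directed away from the root. Let $\log'_d k$ denote the largest integer $i$ for which $1+d+d^2+\dots+d^{i-1}\le k$ holds. Then $$pa_k(T_d(n))=si_k(T_d(n))=\left\lceil \frac{n}{\log'_d k}\right\rceil .$$
   Context: Search model. Let $G$ be a finite directed acyclic (multi)graph with exactly one source. A sink is a vertex with no outgoing edge. A hidden set $E^*$ of edges contains exactly one outgoing edge of every non-sink vertex (and nothing else); following the edges of $E^*$ from the source yields a unique directed path $P(E^* )$ from the source to a sink. A question is a non-sink vertex $v$; its answer is the outgoing edge of $v$ that belongs to $E^*$. In each round up to $k$ questions are asked simultaneously; all answers of the round are then revealed, and later rounds may depend on the answers of earlier rounds. $pa_k(G)$ is the minimal number of rounds that suffices in the worst case (over all $E^*$, for a best deterministic strategy) to determine the path $P(E^* )$, and $si_k(G)$ is the minimal number of rounds that suffices in the worst case to determine the sink in which $P(E^* )$ ends. In the complete $d$-ary tree on $n+1$ levels $T_d(n)$, the root is alone on the first level, each vertex on the first $n$ levels has exactly $d$ children on the next level, and the vertices on level $n+1$ are the leaves (sinks). Every root-to-leaf path has $n$ edges. *)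

(* Defs.v *)
From mathcomp Require Import all_boot.

Set Implicit Arguments.
Unset Strict Implicit.
Unset Printing Implicit Defensive.

Definition arc (V E : finType) (src tgt : E -> V) : rel V :=
  fun u v => [exists e, (src e == u) && (tgt e == v)].

(* Edges form a type of their own, so parallel edges are allowed.  The last
   field says that [root] is a vertex without incoming edge, and the only one. *)
Record dag : Type := Dag {
  vertex : finType;
  edge : finType;
  src : edge -> vertex;
  tgt : edge -> vertex;
  dag_acyclic : forall u v, arc src tgt u v -> ~~ connect (arc src tgt) v u;
  root : vertex;
  dag_source : forall v, [forall e, tgt e != v] = (v == root) }.

Section SearchModel.

Variable G : dag.

Definition is_sink (v : vertex G) : bool := [forall e : edge G, src e != v].

(* Every edge starts at a non-sink, so such a set has no further edges. *)
Definition hidden_set (Es : {set edge G}) : Prop :=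
  forall v, ~~ is_sink v -> #|[set e in Es | src e == v]| = 1.

Fixpoint dpath (v : vertex G) (p : seq (edge G)) : bool :=
  if p is e :: p' then (src e == v) && dpath (tgt e) p' else true.

Definition endpoint (p : seq (edge G)) : vertex G :=
  last (root G) (map (@tgt G) p).

(* [p] is the path P(Es), as a list of edges. *)
Definition hidden_path (Es : {set edge G}) (p : seq (edge G)) : Prop :=
  [/\ dpath (root G) p, {subset p <= Es} & is_sink (endpoint p)].

Definition hidden_sink (Es : {set edge G}) (v : vertex G) : Prop :=
  exists2 p, hidden_path Es p & v = endpoint p.

(* A strategy either stops and reports a result, or asks the vertices of [Q]
   in one round and goes on depending on the answers.  The answers of a round
   are encoded as the set of revealed edges; since their tails are the vertices
   asked, this set tells which edge answers which question. *)
Inductive strategy (A : Type) : Type :=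
  | Stop of A
  | Ask (Q : {set vertex G}) of ({set edge G} -> strategy A).

Definition answers (Es : {set edge G}) (Q : {set vertex G}) : {set edge G} :=
  [set e in Es | src e \in Q].

Fixpoint admissible (A : Type) (k : nat) (t : strategy A) : Prop :=
  if t is Ask Q next then
    [/\ forall v, v \in Q -> ~~ is_sink v,
        #|Q| <= k
      & forall a, admissible k (next a)]
  else True.

Fixpoint result (A : Type) (Es : {set edge G}) (t : strategy A) : A :=
  match t with
  | Stop a => a
  | Ask Q next => result Es (next (answers Es Q))
  end.

Fixpoint rounds (A : Type) (Es : {set edge G}) (t : strategy A) : nat :=
  match t with
  | Stop _ => 0
  | Ask Q next => (rounds Es (next (answers Es Q))).+1
  end.

Definition solvable_in (A : Type) (goal : {set edge G} -> A -> Prop)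
    (k r : nat) : Prop :=
  exists2 t : strategy A, admissible k t
    & forall Es, hidden_set Es -> goal Es (result Es t) /\ rounds Es t <= r.

End SearchModel.

Definition is_least (P : nat -> Prop) (m : nat) : Prop :=
  P m /\ forall r, P r -> m <= r.

(* pa_k(G) = m and si_k(G) = m, including the existence of the minimum (there
   is none in general when k = 0). *)
Definition is_pa (k : nat) (G : dag) (m : nat) : Prop :=
  is_least (solvable_in (@hidden_path G) k) m.

Definition is_si (k : nat) (G : dag) (m : nat) : Prop :=
  is_least (solvable_in (@hidden_sink G) k) m.

Lemma hidden_path_exists (G : dag) (Es : {set edge G}) :
  hidden_set Es -> exists p, hidden_path Es p.
Proof.
move=> HE; rewrite /hidden_path /endpoint.
have [m] := ubnP #|[set v | connect (arc (@src G) (@tgt G)) (root G) v]|.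
elim: m (root G) => // m IH v lt_m.
have [sv|nsv] := boolP (is_sink v); first by exists [::].
have /eqP/cards1P[e He] := HE v nsv.
have: e \in [set e] by rewrite inE.
rewrite -He inE => /andP[eE /eqP sev].
have av : arc (@src G) (@tgt G) v (tgt e).
  by apply/existsP; exists e; rewrite sev !eqxx.
have [|p [dp sp kp]] := IH (tgt e).
  rewrite -ltnS; apply: leq_trans lt_m; rewrite ltnS; apply: proper_card.
  apply/properP; split.
    by apply/subsetP=> w; rewrite !inE; apply: connect_trans; apply: connect1.
  by exists v; rewrite !inE ?connect0 // dag_acyclic.
exists (e :: p); split => //=; first by rewrite sev eqxx.
by move=> f; rewrite inE => /orP[/eqP->//|/sp].
Qed.

Lemma hidden_path_unique (G : dag) (Es : {set edge G}) p q :
  hidden_set Es -> hidden_path Es p -> hidden_path Es q -> p = q.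
Proof.
move=> HE; rewrite /hidden_path /endpoint.
elim: p q (root G) => [|e p IH] [|f q] v //=.
- by move=> [_ _ /forallP sv] [/andP[/eqP fv _] _ _]; have:= sv f; rewrite fv eqxx.
- by move=> [/andP[/eqP ev _] _ _] [_ _ /forallP sv]; have:= sv e; rewrite ev eqxx.
move=> [/andP[/eqP ev dp] sp kp] [/andP[/eqP fv dq] sq kq].
have nsv : ~~ is_sink v by apply/forallPn; exists e; rewrite ev eqxx.
have /eqP/cards1P[g Hg] := HE v nsv.
have eg : e = g.
  by apply/set1P; rewrite -Hg inE ev eqxx andbT; apply: sp; rewrite mem_head.
have fg : f = g.
  by apply/set1P; rewrite -Hg inE fv eqxx andbT; apply: sq; rewrite mem_head.
subst f g; congr cons; apply: (IH _ (tgt e)); split=> // x xp;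
  [apply: sp|apply: sq]; by rewrite inE xp orbT.
Qed.

(* A vertex is the word of child indices leading to it from the root, hence of
   length at most n; an edge is an inner vertex together with a child index. *)
Section CompleteTree.

Variables d n : nat.

Definition tree_vertex : finType := n.-bseq 'I_d.

Definition tree_edge : finType := ({v : tree_vertex | size v < n} * 'I_d)%type.

Definition tree_src (e : tree_edge) : tree_vertex := val e.1.

Lemma tree_tgt_subproof (e : tree_edge) : size (rcons (val e.1) e.2) <= n.
Proof. by rewrite size_rcons; exact: (valP e.1). Qed.

Definition tree_tgt (e : tree_edge) : tree_vertex := Bseq (tree_tgt_subproof e).

Lemma tree_acyclic u v :
  arc tree_src tree_tgt u v -> ~~ connect (arc tree_src tree_tgt) v u.
Proof.
have arcS x y : arc tree_src tree_tgt x y -> size y = (size x).+1.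
  by move=> /existsP[e /andP[/eqP<- /eqP<-]]; rewrite /= size_rcons.
move=> /arcS uv; apply/negP => /connectP[p]; elim: p v uv => [|w p IH] v /=.
  by move=> + _ vu; rewrite vu => /eqP; rewrite -[X in X == _]addn0 -addn1 eqn_add2l.
suff gen (x : tree_vertex) q :
    path (arc tree_src tree_tgt) x q -> size x <= size (last x q).
  move=> vu pvw uE; have := gen v (w :: p) pvw.
  by rewrite /= -uE vu ltnn.
elim: q x => //= y q IHq x /andP[/arcS xy /IHq]; apply: leq_trans.
by rewrite xy leqnSn.
Qed.

Lemma tree_source v : [forall e, tree_tgt e != v] = (v == [bseq]).
Proof.
apply/forallP/eqP => [noin|-> e]; last first.
  by rewrite -val_eqE /= -size_eq0 size_rcons.
apply/val_inj => /=; case: v noin => s; elim/last_ind: s => // s x _ sn noin.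
have ltn : size s < n by rewrite -(size_rcons s x).
have := noin (Sub (Bseq (ltnW ltn) : tree_vertex) ltn, x).
by rewrite -val_eqE /= eqxx.
Qed.

Definition complete_tree : dag := Dag tree_acyclic tree_source.

End CompleteTree.

(* The bound i <= k on the range loses nothing when d > 0, see [log'P]. *)
Definition log' (d k : nat) : nat :=
  \max_(i < k.+1 | \sum_(j < i) d ^ j <= k) i.

Lemma log'P d k i : 0 < d -> (\sum_(j < i) d ^ j <= k) = (i <= log' d k).
Proof.
move=> d_gt0.
have mono a b : a <= b -> \sum_(j < a) d ^ j <= \sum_(j < b) d ^ j.
  by move=> ab; rewrite -(subnKC ab) big_split_ord /= leq_addr.
apply/idP/idP => [le_k|].
  have ik : i < k.+1.
    rewrite ltnS; apply: leq_trans le_k.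
    rewrite -[X in X <= _]card_ord -sum1_card.
    by apply: leq_sum => j _; rewrite expn_gt0 d_gt0.
  by rewrite /log' (bigmax_sup (Ordinal ik)).
move/mono/leq_trans; apply; rewrite /log'.
have P0 : \sum_(j < @ord0 k) d ^ j <= k by rewrite big_ord0.
by rewrite (bigmax_eq_arg ord0) //; case: arg_maxnP.
Qed.

(* Main.v *)
Require Import Defs.
From mathcomp Require Import all_boot all_order all_algebra.

(* Let L = log'_d k.  Asking in each round the top L levels of the subtree below
   the last known path vertex gains L levels per round.  Conversely, an adversary
   keeps a complete d-ary tree of undecided vertices topologically embedded in
   the tree of remaining possibilities: since k < 1 + d + ... + d^L, it can
   answer every round so that the height of this tree drops by at most L,
   wherever the questions are, and a positive height leaves two possible sinks. *)

Lemma dpath_cat (G : dag) (v : vertex G) p q :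
  dpath v (p ++ q) = dpath v p && dpath (last v (map (@tgt G) p)) q.
Proof. by elim: p v => //= e p IH v; rewrite IH andbA. Qed.

(** * Partial commitments and the tree height they leave *)

Section Choices.

Set Implicit Arguments.
Unset Strict Implicit.
Unset Printing Implicit Defensive.

Variable d : nat.
Hypothesis d_gt1 : 1 < d.

Definition child (A : Type) (i : 'I_d) (c : seq 'I_d -> A) (u : seq 'I_d) : A :=
  c (i :: u).

Definition agrees (c c' : seq 'I_d -> option 'I_d) : Prop :=
  forall u i, c u = Some i -> c' u = Some i.

(* A partial function [c] commits some inner vertices of the complete tree of
   height [m] to an outgoing edge.  Contracting committed vertices to the child
   they lead to must leave a complete tree of height at least [h]. *)
Fixpoint leaves_height (m : nat) (c : seq 'I_d -> option 'I_d) (h : nat) :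
    Prop :=
  match m, h with
  | _, 0 => True
  | 0, _.+1 => False
  | m'.+1, h'.+1 =>
    if c [::] is Some i then leaves_height m' (child i c) h
    else forall i, leaves_height m' (child i c) h'
  end.

Lemma eq_leaves_height m c c' h :
  c =1 c' -> leaves_height m c h -> leaves_height m c' h.
Proof.
elim: m c c' h => [|m IH] c c' [|h] //= eq_c.
have eq_child i : child i c =1 child i c' by move=> u; apply: eq_c.
rewrite -eq_c; case: (c [::]) => [i|H i]; first exact: IH (eq_child i).
exact: IH (eq_child i) (H i).
Qed.

Lemma leaves_height_none m h : h <= m -> leaves_height m (fun=> None) h.
Proof. by elim: m h => [|m IH] [|h] //= le_hm i; apply: IH. Qed.

Lemma leaves_height_some m c h i :
  c [::] = Some i -> leaves_height m (child i c) h -> leaves_height m.+1 c h.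
Proof. by case: h => //= h ->. Qed.

(** * Answering one round of questions *)

Definition subwords (i : 'I_d) (Q : seq (seq 'I_d)) : seq (seq 'I_d) :=
  pmap (fun u => if u is j :: u' then if j == i then Some u' else None
                 else None) Q.

Lemma mem_subwords i Q u : i :: u \in Q -> u \in subwords i Q.
Proof.
by move=> iuQ; rewrite mem_pmap; apply/mapP; exists (i :: u); rewrite ?eqxx.
Qed.

Lemma size_subwords i Q : size (subwords i Q) <= size Q.
Proof. by rewrite size_pmap count_size. Qed.

Lemma sum_size_subwords Q :
  count_mem [::] Q + \sum_i size (subwords i Q) = size Q.
Proof.
elim: Q => [|u Q IH] /=; first by rewrite big1.
rewrite -IH; case: u => [|j u] /=; first by rewrite -addnA.
rewrite add0n -addnS; congr (_ + _); rewrite (bigD1 j) //= [in RHS](bigD1 j) //=.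
rewrite eqxx /= addSn; congr (_ + _).+1; apply: eq_bigr => i.
by rewrite eq_sym => /negPf->.
Qed.

(** Pigeonhole: otherwise the root and the [d] subtrees would together hold at least [1 + d (1 + ...
    + d^(j-1)) = 1 + ... + d^j] questions. *)
Lemma few_subwords Q j : [::] \in Q -> size Q < \sum_(i < j.+1) d ^ i ->
  exists i, size (subwords i Q) < \sum_(i < j) d ^ i.
Proof.
move=> Q0 ltQ; apply/existsP; apply: contraLR ltQ => /existsPn many.
rewrite -leqNgt -sum_size_subwords big_ord_recl expn0 leq_add //.
  by rewrite -has_count has_pred1.
have -> : \sum_(i < j) d ^ bump 0 i = \sum_(i < d) \sum_(i < j) d ^ i.
  rewrite sum_nat_const card_ord big_distrr /=.
  by apply: eq_bigr => i _; rewrite expnS.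
by apply: leq_sum => i _; rewrite leqNgt.
Qed.

(* Decide the root for the child [i], below which [c1] is used; the subtrees of
   the other children become unreachable, so their answers are arbitrary. *)
Definition steer (i : 'I_d) (c1 c : seq 'I_d -> option 'I_d) (u : seq 'I_d) :=
  if u is j :: u' then if j == i then c1 u' else Some (odflt i (c u))
  else Some i.

(** A decided root is contracted, so the height left below child [i] survives unchanged. The first
    hypothesis covers both an undecided root and one already committed to [i]. *)
Lemma steerP m h i c1 c Q :
    (c [::] = None \/ c [::] = Some i) ->
    agrees (child i c) c1 -> {in subwords i Q, forall u, c1 u} ->
    leaves_height m c1 h ->
  [/\ agrees c (steer i c1 c), {in Q, forall u, steer i c1 c u}
    & leaves_height m.+1 (steer i c1 c) h].
Proof.
move=> ci cc1 c1Q hc1; split.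
- move=> [|j u] l /=; first by case: ci => -> //.
  by case: eqP => [->|_]; [apply: cc1 | move=> ->].
- by move=> [|j u] //= juQ; case: eqP juQ => [-> /mem_subwords/c1Q|].
- apply: (@leaves_height_some _ _ _ i) => //.
  by apply: eq_leaves_height hc1 => u; rewrite /child /= eqxx.
Qed.

Lemma commit_all m c (Q : seq (seq 'I_d)) :
  exists c', [/\ agrees c c', {in Q, forall u, c' u} & leaves_height m c' 0].
Proof.
exists (fun u => Some (odflt (Ordinal (ltnW d_gt1)) (c u))).
by split=> [u i -> //|//|]; case: m.
Qed.

(* A round of fewer than 1 + d + ... + d^j questions costs at most j levels: an
   asked root eats one level but leaves some child with fewer than
   1 + d + ... + d^(j-1) questions; an unasked root is kept, and the loss of
   its subtree is the maximal loss of its children. *)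
Lemma commit m c h (Q : seq (seq 'I_d)) j :
    leaves_height m c h -> size Q < \sum_(i < j.+1) d ^ i ->
  exists c', [/\ agrees c c', {in Q, forall u, c' u}
               & leaves_height m c' (h - j)].
Proof.
elim: m c h j Q => [|m IH] c h j Q hc ltQ.
  by case: h hc => // _; apply: commit_all.
have [le_hj|] := leqP h j; first by rewrite (eqP le_hj); apply: commit_all.
case: h hc => // h hc le_jh.
have IHi i h' : leaves_height m (child i c) h' -> exists c1,
    [/\ agrees (child i c) c1, {in subwords i Q, forall u, c1 u}
      & leaves_height m c1 (h' - j)].
  by move/IH; apply; apply: leq_ltn_trans (size_subwords i Q) ltQ.
case c0: (c [::]) hc => [i|] /=; rewrite c0 => hc.
  have [c1 [cc1 c1Q hc1]] := IHi i _ hc.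
  by exists (steer i c1 c); apply: steerP => //; right.
have [Q0|nQ0] := boolP ([::] \in Q).
  case: j le_jh ltQ {IHi} => [|j] le_jh ltQ.
    by move: ltQ; rewrite big_ord1 ltnS leqn0 size_eq0; case: Q Q0.
  have [i ltQi] := few_subwords Q0 ltQ.
  have [c1 [cc1 c1Q hc1]] := IH _ _ _ _ (hc i) ltQi.
  by exists (steer i c1 c); rewrite subSS; apply: steerP => //; left.
have [g gP] := fin_all_exists (fun i => IHi i _ (hc i)).
exists (fun u => if u is i :: u' then g i u' else None); split.
- by move=> [|i u] l; [rewrite c0 | case: (gP i) => + _ _; apply].
- move=> [|i u]; first by rewrite (negPf nQ0).
  by move=> /mem_subwords uQ; case: (gP i) => _ + _; apply.
- by rewrite subSn //= => i; case: (gP i).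
Qed.

(** * Total choices and the leaves they lead to *)

Definition extends (c : seq 'I_d -> option 'I_d) (f : seq 'I_d -> 'I_d) : Prop :=
  forall u i, c u = Some i -> f u = i.

Lemma agrees_extends c c' f : agrees c c' -> extends c' f -> extends c f.
Proof. by move=> cc' c'f u i /cc'/c'f. Qed.

Definition walk (f : seq 'I_d -> 'I_d) (m : nat) : seq 'I_d :=
  iter m (fun u => rcons u (f u)) [::].

Lemma size_walk f m : size (walk f m) = m.
Proof. by elim: m => //= m IH; rewrite size_rcons IH. Qed.

(** [walk] grows at its end, whereas inductions on the tree split off the first step; this bridges
    the two. *)
Lemma walkS f m : walk f m.+1 = f [::] :: walk (child (f [::]) f) m.
Proof. by elim: m => //= m ->. Qed.

(** Following the commitments from the root, one meets an undecided vertex, since the height is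
    positive; two different choices there separate the walks. *)
Lemma ambiguous_walk m c h : leaves_height m c h -> 0 < h ->
  exists f f', [/\ extends c f, extends c f' & walk f m <> walk f' m].
Proof.
elim: m c h => [|m IH] c [|h] //.
(* Go to child [i], use [g] below it, and complete [c] arbitrarily in the subtrees that the walk
   avoids. *)
pose full i (g : seq 'I_d -> 'I_d) u :=
  if u is j :: u' then if j == i then g u' else odflt i (c u) else i.
have full_ext i g : c [::] = None \/ c [::] = Some i -> extends (child i c) g ->
    extends c (full i g).
  move=> ci cg [|j u] l /=; first by case: ci => -> // [].
  by case: eqP => [->|_]; [apply: cg | move=> ->].
have walk_full i g : walk (full i g) m.+1 = i :: walk g m.
  rewrite walkS /=; congr (_ :: _).
  by elim: m {IH} => //= m ->; rewrite /child /= eqxx.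
case c0: (c [::]) => [i|] hc _; rewrite /= c0 in hc.
  have [g [g' [cg cg' neq]]] := IH _ _ hc isT.
  exists (full i g), (full i g'); split; try by apply: full_ext => //; right.
  by rewrite !walk_full => -[].
pose g i u := odflt (Ordinal d_gt1) (child i c u).
have cg i : extends (child i c) (g i) by move=> u l; rewrite /g => ->.
(* The child indices 0 and 1, both available because [d >= 2]. *)
pose i0 := Ordinal (ltnW d_gt1); pose i1 := Ordinal d_gt1.
exists (full i0 (g i0)), (full i1 (g i1)); split; try by apply: full_ext => //; left.
by rewrite !walk_full => -[].
Qed.

(** * From choices to hidden sets of edges *)

Section Tree.

Variable n : nat.

Notation tree := (complete_tree d n).

Lemma is_sinkE (v : vertex tree) : is_sink v = (size (val v) == n).
Proof.
apply/forallP/eqP => [sink|sz_v e]; last first.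
  by apply: contraTneq (valP e.1) => ev; rewrite [val _]ev sz_v ltnn.
apply/eqP; rewrite eqn_leq (valP v) leqNgt; apply/negP => lt_v.
by have := sink (Sub v lt_v, Ordinal d_gt1); rewrite /= /tree_src /= eqxx.
Qed.

Lemma nsinkE (v : vertex tree) : ~~ is_sink v = (size (val v) < n).
Proof. by rewrite is_sinkE ltn_neqAle (valP v) andbT. Qed.

Definition choice_edges (f : seq 'I_d -> 'I_d) : {set edge tree} :=
  [set e : edge tree | e.2 == f (val (src e))].

Lemma choice_edges_hidden f : hidden_set (choice_edges f).
Proof.
move=> v; rewrite nsinkE => lt_v; apply/eqP/cards1P.
exists (Sub v lt_v, f (val v)); apply/setP => -[u i]; rewrite !inE /=.
rewrite /tree_src xpair_eqE -(inj_eq val_inj u) /= andbC.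
by case: (val u =P v) => //= ->.
Qed.

Lemma answers_choice_edges f f' (Q : {set vertex tree}) :
    {in Q, forall v, f (val v) = f' (val v)} ->
  answers (choice_edges f) Q = answers (choice_edges f') Q.
Proof.
move=> eq_f; apply/setP => e; rewrite !inE.
by case: (boolP (src e \in Q)) => [/eq_f->|]; rewrite ?andbF.
Qed.

Lemma hidden_path_walk f p :
  hidden_path (choice_edges f) p -> val (endpoint p) = walk f n.
Proof.
(* Generalised to a start after [i] steps of the walk, so that induction on [p] applies. *)
have dpath_walk (v : vertex tree) i : val v = walk f i -> dpath v p ->
    {subset p <= choice_edges f} ->
    val (last v (map (@tgt tree) p)) = walk f (i + size p).
  elim: p v i => [|e p IH] v i vi /=; first by rewrite addn0.
  move=> /andP[/eqP ev dp] sub_p; rewrite addnS -addSn; apply: IH => //.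
    have := sub_p e (mem_head _ _); rewrite inE => /eqP /= e2.
    by rewrite /= e2 -vi -ev.
  by move=> g gp; apply: sub_p; rewrite inE gp orbT.
case=> dp sub_p; rewrite is_sinkE /endpoint.
rewrite (dpath_walk _ 0 _ dp sub_p) //.
by rewrite size_walk => /eqP ->.
Qed.

(** * The lower bound by an adversary *)

Variable k : nat.
Notation L := (log' d k).

(** Induction on the strategy: each round is answered by [commit] at a cost of at most [L] levels,
    so positive height remains when the strategy stops, and [ambiguous_walk] applies. *)
Lemma adversary A (t : strategy tree A) r c h :
    admissible k t -> leaves_height n c h -> r * L < h ->
    (forall f, extends c f -> rounds (choice_edges f) t <= r) ->
  exists f f', [/\ extends c f, extends c f',
    result (choice_edges f) t = result (choice_edges f') t
    & walk f n <> walk f' n].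
Proof.
elim: t r c h => [a|Q next IH] r c h /= adm hc lt_h tr.
  have [f [f' [cf cf' neq]]] := ambiguous_walk hc (leq_ltn_trans (leq0n _) lt_h).
  by exists f, f'.
case: adm => _ leQ adm.
(* Maximality of [L] gives [k < 1 + d + ... + d^L]. *)
have ltQ : size [seq val v | v <- enum Q] < \sum_(i < L.+1) d ^ i.
  rewrite size_map -cardE; apply: leq_ltn_trans leQ _.
  by rewrite ltnNge log'P ?ltnn // ltnW.
have [c' [cc' c'Q hc']] := commit hc ltQ.
(* Any completion of [c'] would do: [c'] decides all of [Q], so every extension gives the same
   answers and the strategy continues in the same way. *)
pose f0 u := odflt (Ordinal d_gt1) (c' u).
have c'f0 : extends c' f0 by move=> u i; rewrite /f0 => ->.
have sameQ f : extends c' f ->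
    answers (choice_edges f) Q = answers (choice_edges f0) Q.
  move=> c'f; apply: answers_choice_edges => v vQ.
  have /c'Q : val v \in [seq val v | v <- enum Q] by rewrite map_f // mem_enum.
  by case c'v: (c' _) => [i|] // _; rewrite (c'f _ _ c'v) (c'f0 _ _ c'v).
case: r lt_h tr => [|r] lt_h tr.
  by have := tr _ (agrees_extends cc' c'f0).
have [|f c'f|f [f' [c'f c'f' res neq]]] :=
  IH _ r c' _ (adm (answers (choice_edges f0) Q)) hc'.
- by rewrite ltn_subRL -mulSn.
- by have := tr f (agrees_extends cc' c'f); rewrite ltnS sameQ.
by exists f, f'; split; rewrite ?sameQ //; apply: agrees_extends cc' _.
Qed.

(** The map [leaf] reads the final leaf off a result, which treats paths and sinks alike. The
    adversary starts from the empty commitment, of height [n]. *)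
Lemma solvable_lower_bound A (goal : {set edge tree} -> A -> Prop)
    (leaf : A -> seq 'I_d) r :
    (forall f a, goal (choice_edges f) a -> leaf a = walk f n) ->
  solvable_in goal k r -> n <= r * L.
Proof.
move=> goal_leaf [t adm solves]; rewrite leqNgt; apply/negP => lt_n.
have solvesf f := solves _ (choice_edges_hidden f).
have [|f [f' [_ _ eq_res]]] := adversary adm (leaves_height_none (leqnn n)) lt_n.
  by move=> f _; case: (solvesf f).
case: (solvesf f) (solvesf f') => /goal_leaf <- _ [/goal_leaf <- _].
by rewrite eq_res.
Qed.

(** * The strategy that gains [L] levels per round *)

Definition top_levels (v : vertex tree) : {set vertex tree} :=
  [set u : vertex tree | [&& prefix (val v) (val u), size (val u) < n
                           & size (val u) < size (val v) + L]].

(** Deleting the prefix [v] is an injection into the words of length at most [L - 1], of which there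
    are [1 + d + ... + d^(L-1) <= k]. *)
Lemma card_top_levels v : 0 < k -> #|top_levels v| <= k.
Proof.
move=> k_gt0; have d_gt0 := ltnW d_gt1.
have L_gt0 : 0 < L by rewrite -log'P // big_ord1.
have: \sum_(i < L.-1.+1) d ^ i <= k by rewrite prednK // log'P.
apply: leq_trans.
have <- : #|{: L.-1.-bseq 'I_d}| = \sum_(i < L.-1.+1) d ^ i.
  by rewrite card_bseq card_ord.
pose f (u : vertex tree) : L.-1.-bseq 'I_d :=
  insub_bseq _ (drop (size (val v)) (val u)).
apply: (@leq_card_in _ _ f) => u w; rewrite !inE.
move=> /and3P[/prefixP[u' uE] _ ltu] /and3P[/prefixP[w' wE] _ ltw] eq_f.
apply: val_inj; rewrite uE wE; congr (_ ++ _); move/(congr1 val): eq_f.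
rewrite !val_insubd uE wE !drop_size_cat //.
move: ltu ltw; rewrite uE wE !size_cat !ltn_add2l -(prednK L_gt0) !ltnS.
by move=> -> ->.
Qed.

Fixpoint follow (a : {set edge tree}) (v : vertex tree) m : seq (edge tree) :=
  if m is m'.+1 then
    if [pick e in a | src e == v] is Some e then e :: follow a (tgt e) m'
    else [::]
  else [::].

(** The bound on [m] keeps every inner vertex met among those asked, so the walk can stop early only
    at a leaf; hence the minimum with [n]. *)
Lemma followP Es v u m (q := follow (answers Es (top_levels v)) u m) :
    hidden_set Es -> prefix (val v) (val u) ->
    size (val u) + m <= size (val v) + L ->
  [/\ dpath u q, {subset q <= Es}
    & size (val (last u (map (@tgt tree) q))) = minn n (size (val u) + m)].
Proof.
move=> HE; rewrite {}/q; elim: m u => [|m IH] u vu le_um /=.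
  by rewrite addn0 (minn_idPr (valP u)).
case: pickP => [e|noe] /=.
  rewrite !inE => /andP[/andP[eE _] /eqP eu].
  have size_e : size (val (@tgt tree e)) = (size (val u)).+1.
    by rewrite /= size_rcons -eu.
  have [||dq qE ->] := IH (@tgt tree e); rewrite ?size_e ?addSnnS //.
    by apply: prefix_trans vu _; rewrite -eu prefix_rcons.
  rewrite eu eqxx; split=> // g; rewrite inE => /orP[/eqP ->|/qE] //.
have [lt_u|le_nu] := ltnP (size (val u)) n; last first.
  have /eqP size_u : size (val u) == n by rewrite eqn_leq (valP u).
  by split=> //; rewrite size_u (minn_idPl (leq_addr _ _)).
have /eqP/cards1P[e eE] : #|[set e in Es | src e == u]| = 1.
  by apply: HE; rewrite nsinkE.
have := noe e; have : e \in [set e] by rewrite inE.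
rewrite -eE !inE /= => /andP[-> /eqP ->]; rewrite vu lt_u eqxx /= andbT => /negP[].
by rewrite (leq_trans _ le_um) // addnS ltnS leq_addr.
Qed.

(** [p] accumulates the known part of the path, [v] is its end, and [g] extracts the result. *)
Fixpoint descend A (g : seq (edge tree) -> A) r (v : vertex tree) p :
    strategy tree A :=
  if r is r'.+1 then
    Ask (top_levels v) (fun a => let q := follow a v L in
      descend g r' (last v (map (@tgt tree) q)) (p ++ q))
  else Stop _ (g p).

Lemma admissible_descend A (g : seq (edge tree) -> A) r v p :
  0 < k -> admissible k (descend g r v p).
Proof.
move=> k_gt0; elim: r v p => //= r IH v p; split=> //; last exact: card_top_levels.
by move=> u; rewrite nsinkE inE => /and3P[].
Qed.

Lemma rounds_descend A (g : seq (edge tree) -> A) Es r v p :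
  rounds Es (descend g r v p) = r.
Proof. by elim: r v p => //= r IH v p; rewrite IH. Qed.

Lemma descendP A (g : seq (edge tree) -> A) Es r v p :
    hidden_set Es -> exists q,
  [/\ result Es (descend g r v p) = g (p ++ q), dpath v q, {subset q <= Es}
    & size (val (last v (map (@tgt tree) q))) = minn n (size (val v) + r * L)].
Proof.
move=> HE; elim: r v p => [|r IH] v p /=.
  by exists [::]; rewrite cats0 addn0 (minn_idPr (valP v)).
have [dq qE size_q] := @followP Es v v L HE (prefix_refl _) (leqnn _).
set q := follow _ _ _ in dq qE size_q *.
have [q' [-> dq' q'E size_q']] := IH (last v (map (@tgt tree) q)) (p ++ q).
exists (q ++ q'); rewrite catA; split=> //.
- by rewrite dpath_cat dq.
- by move=> e; rewrite mem_cat => /orP[/qE|/q'E].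
- rewrite map_cat last_cat size_q' size_q addn_minl mulSn addnA minnA; congr minn.
  by apply/minn_idPl; rewrite leq_addr.
Qed.

Lemma solvable_upper_bound A (goal : {set edge tree} -> A -> Prop)
    (g : seq (edge tree) -> A) r :
    (forall Es p, hidden_path Es p -> goal Es (g p)) -> 0 < k ->
  n <= r * L -> solvable_in goal k r.
Proof.
move=> goal_g k_gt0 le_n.
exists (descend g r (Defs.root tree) [::]); first exact: admissible_descend.
move=> Es HE; rewrite rounds_descend; split=> //.
have [q [-> dq qE size_q]] := descendP g r (Defs.root tree) [::] HE.
apply: goal_g; split=> //.
by rewrite is_sinkE /endpoint size_q /= add0n (minn_idPl le_n).
Qed.

End Tree.

End Choices.

(** * The minimum as a ceiling *)

Theorem theorem3 (d n k : nat) (hd : 2 <= d) (hn : 1 <= n) (hk : 1 <= k) :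
  exists m : nat,
    [/\ is_pa k (complete_tree d n) m,
        is_si k (complete_tree d n) m
      & m%:Z%R = Num.ceil (n%:Q / (log' d k)%:Q)%R].
Proof.
have L_gt0 : 0 < log' d k by rewrite -log'P ?(ltnW hd) // big_ord1.
set x := (n%:Q / (log' d k)%:Q)%R.
have ceil_x_ge0 : (0 <= Num.ceil x)%R.
  rewrite Num.Theory.ceil_ge0.
  apply: (@Order.POrderTheory.lt_le_trans _ _ 0%R) => //.
  by apply: Num.Theory.divr_ge0; apply: Num.Theory.ler0n.
have ceilE : (`|Num.ceil x|%N%:Z = Num.ceil x)%R by rewrite gez0_abs.
(* This equivalence turns both bounds into statements about the ceiling; the absolute value only
   makes it a natural number. *)
have ceil_leq r : (`|Num.ceil x|%N <= r)%N = (n <= r * log' d k)%N.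
  rewrite -lez_nat ceilE Num.Theory.ceil_le_int.
  by rewrite Num.Theory.ler_pdivrMr ?Num.Theory.ltr0n //
    -GRing.Theory.natrM Num.Theory.ler_nat.
have le_n : n <= `|Num.ceil x|%N * log' d k by rewrite -ceil_leq.
exists `|Num.ceil x|%N; split=> //; split.
- by apply: (solvable_upper_bound hd (g := id)).
- move=> r; rewrite ceil_leq.
  pose leaf (p : seq (edge (complete_tree d n))) : seq 'I_d := val (endpoint p).
  apply: (@solvable_lower_bound _ hd _ _ _ _ leaf) => f p.
  exact: hidden_path_walk.
- apply: (solvable_upper_bound hd (g := @endpoint (complete_tree d n))) => // Es p pP.
  by exists p.
- move=> r; rewrite ceil_leq.
  pose leaf (v : vertex (complete_tree d n)) : seq 'I_d := val v.
  apply: (@solvable_lower_bound _ hd _ _ _ _ leaf) => f v [p pP ->].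
  exact: hidden_path_walk pP.
Qed.
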